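(* Let $\Delta$ and $\Sigma$ be finite alphabets, $w\in\Delta^*$, $\psi:\Delta^*\to\Delta^*$ a non-erasing morphism of free monoids, and $\tau:\Delta\to\Sigma$ a map (extended letter-wise to strings). Then there is a constant $C$ such that $\ell(\tau(\psi^d(w)))\le C$ for every $d>0$; that is, $\ell=O(1)$ on the family $\{\tau(\psi^d(w)) : d>0\}$.
   Context: A morphism $\psi:\Delta^*\to\Delta^*$ satisfies $\psi(xy)=\psi(x)\psi(y)$ and is determined by its values on letters; it is non-erasing if $|\psi(a)|>0$ for every $a\in\Delta$. $\psi^d$ denotes the $d$-fold composition. L-system: a tuple $L=(V,R,S,\tau,d,n)$ where $V$ is a finite set of variables, $R: V\to V^+$ assigns to each variable a nonempty string (extended homomorphically to strings), $S\in V^*$ is the axiom, $\tau: V\to V$ is a coding (letter-to-letter map, extended homomorphically), $d\in\mathbb{N}$ and $n\in\mathbb{N}$. Its levels are $L_0=S$ and $L_{i+1}=R(L_i)$; it generates the string $w[1,n]=\tau(L_d[1,n])$. Its size is $|S|+\sum_{A\in V}|R(A)|$. $\ell(x)$ is the size of the smallest L-system generating a string $x$. *)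

(* Defs.v *)
From HB Require Import structures.
From mathcomp Require Import all_boot finmap boolp.

Set Implicit Arguments.
Unset Strict Implicit.
Unset Printing Implicit Defensive.

Local Open Scope fset_scope.

(* Alphabets and variable sets are finite sets of symbols drawn from one
   ambient type [Sym]: the string generated by an L-system is a string over
   its own variables, so symbols of different systems must be comparable. *)

(* Since [seq] is cancellative, this forces [psi [::] = [::]]. *)
Definition morphism (A B : Type) (psi : seq A -> seq B) : Prop :=
  {morph psi : x y / x ++ y}.

Definition non_erasing (A B : Type) (psi : seq A -> seq B) : Prop :=
  forall a, 0 < size (psi [:: a]).

Definition hom_ext (A B : Type) (f : A -> seq B) (s : seq A) : seq B :=
  flatten (map f s).

Record lsystem (Sym : choiceType) := LSystem {
  lvars : {fset Sym};
  lrule : lvars -> seq lvars;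
  lrule_nonempty : forall A, lrule A <> [::];
  laxiom : seq lvars;
  lcoding : lvars -> lvars;
  ldepth : nat;
  llength : nat
}.

Definition llevel (Sym : choiceType) (L : lsystem Sym) (i : nat) :
  seq (lvars L) := iter i (hom_ext (@lrule _ L)) (laxiom L).

Definition symbols (Sym : choiceType) (A : {fset Sym}) (s : seq A) : seq Sym :=
  map val s.

(* [take] is total; the prefix of length n is only defined if the level has
   at least n letters. *)
Definition generates (Sym : choiceType) (L : lsystem Sym) (x : seq Sym) : Prop :=
  llength L <= size (llevel L (ldepth L)) /\
  x = symbols (map (@lcoding _ L) (take (llength L) (llevel L (ldepth L)))).

Definition lsize (Sym : choiceType) (L : lsystem Sym) : nat :=
  size (laxiom L) + \sum_(A : lvars L) size (lrule A).

Definition generated_with_size (Sym : choiceType) (x : seq Sym) : pred nat :=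
  fun k => `[< exists L : lsystem Sym, generates L x /\ lsize L = k >].

Lemma generated_with_some_size (Sym : choiceType) (x : seq Sym) :
  exists k, generated_with_size x k.
Proof.
pose V := [fset a in x].
have nonempty (A : V) : [:: A] <> [::] by [].
pose S : seq V := pmap insub x.
have SE : symbols S = x.
  rewrite /symbols /S pmap_filter; last exact: insubK.
  apply/all_filterP/allP => a ax.
  by rewrite isSome_insub inE.
pose L := LSystem nonempty S id 0 (size S).
exists (lsize L); apply/asboolP; exists L; split => //.
by split; rewrite /llevel //= take_size map_id SE.
Qed.

Definition ell (Sym : choiceType) (x : seq Sym) : nat :=
  ex_minn (generated_with_some_size x).

(* Main.v *)
(* One L-system on the variables Delta `|` Sigma, with rules psi, axiom w and
   coding tau, generates every tau (psi^d w): only its depth and length vary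
   with d, and these do not count towards the size. *)
Require Import Defs.
From mathcomp Require Import all_boot finmap.
From mathcomp Require Import boolp.

Lemma morphism_nil (A B : Type) (f : seq A -> seq B) :
  morphism f -> f [::] = [::].
Proof.
(* Splitting the empty word as [[::] ++ [::]] makes the length n of its image satisfy n + n = n. *)
move=> fM; apply/size0nil/(@addnI (size (f [::]))).
by rewrite -size_cat -fM addn0.
Qed.

Lemma morphism_hom_ext (A B : Type) (f : seq A -> seq B) :
  morphism f -> f =1 hom_ext (fun a => f [:: a]).
Proof.
move=> fM; elim=> [|a s IHs]; first exact: (morphism_nil _ _ f).
by rewrite -cat1s fM IHs.
Qed.

Lemma ell_leq (Sym : choiceType) (L : lsystem Sym) (x : seq Sym) :
  generates L x -> ell x <= lsize L.
Proof.
move=> Lx; rewrite /ell; case: ex_minnP => m _; apply.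
by apply/asboolP; exists L.
Qed.

Section MorphicLsystem.

Context (Sym : choiceType) (Delta Sigma : {fset Sym}).
Context (psi : seq Delta -> seq Delta) (tau : Delta -> Sigma).
Hypotheses (psi_morphism : morphism psi) (psi_non_erasing : non_erasing psi).

Local Notation V := (Delta `|` Sigma)%fset.

Definition source_var : Delta -> V := fincl (fsubsetUl Delta Sigma).
(** A coding maps variables to variables, so the output letters have to be variables as well. *)
Definition target_var : Sigma -> V := fincl (fsubsetUr Delta Sigma).

(* Delta and Sigma may overlap: a shared symbol is read as a letter of Delta. *)
Definition morphic_rule (A : V) : seq V :=
  if insub (val A) is Some a then map source_var (psi [:: a]) else [:: A].

Definition morphic_coding (A : V) : V :=
  if insub (val A) is Some a then target_var (tau a) else A.

Lemma morphic_rule_nonempty A : morphic_rule A <> [::].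
Proof.
rewrite /morphic_rule; case: insub => // a.
by have := psi_non_erasing a; case: (psi _).
Qed.

Definition morphic_lsystem (w : seq Delta) (d : nat) : lsystem Sym :=
  LSystem morphic_rule_nonempty (map source_var w) morphic_coding d
    (size (iter d psi w)).

Lemma morphic_rule_source a :
  morphic_rule (source_var a) = map source_var (psi [:: a]).
(* [source_var] keeps the underlying symbol, so [insub] recovers [a], even if that symbol also lies
   in [Sigma]. *)
Proof. by rewrite /morphic_rule /= valK. Qed.

Lemma morphic_coding_source a :
  morphic_coding (source_var a) = target_var (tau a).
Proof. by rewrite /morphic_coding /= valK. Qed.

(** Both sides are morphisms in [s], so agreement on single letters suffices. Iterating this
    identity describes all levels. *)
Lemma hom_ext_morphic_rule s :
  hom_ext morphic_rule (map source_var s) = map source_var (psi s).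
Proof.
rewrite (morphism_hom_ext _ _ psi psi_morphism) /hom_ext map_flatten -!map_comp.
by congr flatten; apply: eq_map => a; apply: morphic_rule_source.
Qed.

Lemma llevel_morphic_lsystem w d i :
  llevel (morphic_lsystem w d) i = map source_var (iter i psi w).
Proof.
rewrite /llevel /=; elim: i => //= i ->.
exact: hom_ext_morphic_rule.
Qed.

Lemma morphic_lsystem_generates w d :
  generates (morphic_lsystem w d) (symbols (map tau (iter d psi w))).
Proof.
rewrite /generates llevel_morphic_lsystem /= size_map; split=> //.
(* The prefix length was chosen as the full length of level [d], so nothing is cut off. *)
rewrite take_oversize ?size_map // /symbols -!map_comp.
by apply: eq_map => a /=; rewrite morphic_coding_source.
Qed.

End MorphicLsystem.

Theorem theorem7 (Sym : choiceType) (Delta Sigma : {fset Sym})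
    (w : seq Delta) (psi : seq Delta -> seq Delta) (tau : Delta -> Sigma)
    (psi_morphism : morphism psi) (psi_non_erasing : non_erasing psi) :
  exists C : nat, forall d : nat, 0 < d ->
    ell (symbols (map tau (iter d psi w))) <= C.
Proof.
(* Depth 0 is an arbitrary representative: [lsize] reads only the axiom and the rules, so this bound
   is convertible to the size at depth [d]. *)
exists (lsize (morphic_lsystem _ _ _ _ tau psi_non_erasing w 0)) => d _.
exact/(ell_leq _ (morphic_lsystem _ _ _ _ tau psi_non_erasing w d))
      /morphic_lsystem_generates.
Qed.
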